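(* Let $\sigma$ be a turn sequence of $n>0$ turns. Then: $\sigma$ contains at least one up hook if and only if some point of the $+y$-axis is reachable by $\sigma$; $\sigma$ contains at least one down hook if and only if some point of the $-y$-axis is reachable by $\sigma$; $\sigma$ contains at least one right hook if and only if some point of the $+x$-axis is reachable by $\sigma$; and $\sigma$ contains at least one left hook if and only if some point of the $-x$-axis is reachable by $\sigma$.
   Context: A turn sequence is a finite word $\sigma=\sigma_1\cdots\sigma_n$ with $\sigma_i\in\{\texttt{L},\texttt{R}\}$ (left turn, right turn). A rectilinear chain realizes $\sigma$ if it is simple (no self-intersection), consists of $n+1$ axis-parallel segments of positive integer length, starts at the origin $o=(0,0)$ with its first segment heading east (direction $+x$), and at its $n$ successive bends makes the $90^\circ$ turns $\sigma_1,\dots,\sigma_n$ in order. Its endpoint $p\in\mathbb{Z}^2$ is said to be reachable by $\sigma$. The $+x$-axis is $\{(a,0):a>0\}$, the $-x$-axis is $\{(a,0):a<0\}$, the $+y$-axis is $\{(0,b):b>0\}$, the $-y$-axis is $\{(0,b):b<0\}$. Hooks: a hook is a pair of consecutive equal turns $\sigma_i\sigma_{i+1}\in\{\texttt{LL},\texttt{RR}\}$; the associated hook segment is the segment of the chain between the $i$th and $(i+1)$st bends. The hook is an up, down, left, right hook if that segment, directed along the chain from $o$ to the endpoint, has direction $+y,-y,-x,+x$ respectively. (The direction depends only on $\sigma$: with $\delta_i=\#\texttt{L}-\#\texttt{R}$ among $\sigma_1,\dots,\sigma_i$, the segment following the $i$th turn has direction $+x,+y,-x,-y$ according to $\delta_i\equiv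 0,1,2,3\pmod 4$.) *)

(* Defs.v *)
From Stdlib Require Import Reals ZArith List.
Import ListNotations.

Inductive turn : Type := TurnL | TurnR.

Inductive dir : Type := East | North | West | South.

Definition rotate (d : dir) (t : turn) : dir :=
  match t, d with
  | TurnL, East => North
  | TurnL, North => West
  | TurnL, West => South
  | TurnL, South => East
  | TurnR, East => South
  | TurnR, South => West
  | TurnR, West => North
  | TurnR, North => East
  end.

Definition unit_vec (d : dir) : Z * Z :=
  match d with
  | East => (1, 0)%Z
  | North => (0, 1)%Z
  | West => (-1, 0)%Z
  | South => (0, -1)%Z
  end.

(* Direction of the segment that follows the first [i] turns, the initial
   segment ([i = 0]) heading east. *)
Definition heading (sigma : list turn) (i : nat) : dir :=
  fold_left rotate (firstn i sigma) East.

(* List positions are 0-based: the entries at positions [i] and [i+1] are the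
   turns number [i+1] and [i+2], so the segment between these two bends comes
   after exactly [i+1] turns. Up, down, left and right hooks are those with
   [d] equal to [North], [South], [West] and [East]. *)
Definition has_hook (d : dir) (sigma : list turn) : Prop :=
  exists (i : nat) (t : turn),
    nth_error sigma i = Some t /\
    nth_error sigma (S i) = Some t /\
    heading sigma (S i) = d.

Definition to_plane (a : Z * Z) : R * R := (IZR (fst a), IZR (snd a)).

(* The closed segment [a, b] of the real plane. *)
Definition in_segment (a b : Z * Z) (q : R * R) : Prop :=
  exists t : R,
    (0 <= t <= 1)%R /\
    q = ((1 - t) * IZR (fst a) + t * IZR (fst b),
         (1 - t) * IZR (snd a) + t * IZR (snd b))%R.

(* A chain with [m] segments is given by its vertices [v 0], ..., [v m]; the
   values of [v] beyond [m] are irrelevant. Segments meet only when they are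
   consecutive, and then only at their common vertex. *)
Definition simple_chain (m : nat) (v : nat -> Z * Z) : Prop :=
  forall (i j : nat) (q : R * R),
    (i < j)%nat -> (j < m)%nat ->
    in_segment (v i) (v (S i)) q ->
    in_segment (v j) (v (S j)) q ->
    j = S i /\ q = to_plane (v j).

Definition realizes (sigma : list turn) (v : nat -> Z * Z) : Prop :=
  v 0%nat = (0, 0)%Z /\
  (forall i : nat, (i <= length sigma)%nat ->
     exists l : Z,
       (0 < l)%Z /\
       v (S i) = (fst (v i) + l * fst (unit_vec (heading sigma i)),
                  snd (v i) + l * snd (unit_vec (heading sigma i)))%Z) /\
  simple_chain (S (length sigma)) v.

Definition reachable (sigma : list turn) (p : Z * Z) : Prop :=
  exists v : nat -> Z * Z,
    realizes sigma v /\ v (S (length sigma)) = p.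

Definition on_pos_x_axis (p : Z * Z) : Prop := (0 < fst p)%Z /\ snd p = 0%Z.
Definition on_neg_x_axis (p : Z * Z) : Prop := (fst p < 0)%Z /\ snd p = 0%Z.
Definition on_pos_y_axis (p : Z * Z) : Prop := fst p = 0%Z /\ (0 < snd p)%Z.
Definition on_neg_y_axis (p : Z * Z) : Prop := fst p = 0%Z /\ (snd p < 0)%Z.

(* Main.v *)
(* Fix a direction [d], called up; columns are the lines parallel to [d].

   If there is no [d]-hook, subdivide the chain into unit steps. Then whenever
   the walk leaves a column and later returns to it, it returns strictly lower,
   by induction on the elapsed time; so the endpoint is not above the origin.

   If there is a [d]-hook, give the segments before and after it lengths that
   shrink like powers of 2 with the distance to the hook, and make the hook long
   enough to separate the two parts. The two neighbours of the hook point in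
   opposite directions, so lengthening one of them aligns the two ends of the
   chain along [d] without spoiling simplicity. *)

Require Import Defs.
From Stdlib Require Import Reals ZArith List.
From Stdlib Require Import Lia Lra Classical Wf_nat.

(** * Coordinates relative to a direction, and chains given by their lengths *)

Definition dot (d : dir) (p : Z * Z) : Z :=
  (fst (unit_vec d) * fst p + snd (unit_vec d) * snd p)%Z.

Definition translate (p : Z * Z) (k : Z) (d : dir) : Z * Z :=
  (fst p + k * fst (unit_vec d), snd p + k * snd (unit_vec d))%Z.

Definition perp (d e : dir) : Prop := dot d (unit_vec e) = 0%Z.

(** With [d] as up, [dot (left_of d)] numbers the columns and [dot d] measures height, so one
    argument serves all four directions. *)
Definition left_of (d : dir) : dir := rotate d TurnL.

Fixpoint vertex (l : nat -> Z) (h : nat -> dir) (k : nat) : Z * Z :=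
  match k with
  | O => (0, 0)%Z
  | S k => translate (vertex l h k) (l k) (h k)
  end.

Fixpoint travelled (l : nat -> Z) (k : nat) : Z :=
  match k with
  | O => 0%Z
  | S k => (travelled l k + l k)%Z
  end.

Local Open Scope Z_scope.

Lemma dot_translate (d e : dir) (p : Z * Z) (k : Z) :
  dot d (translate p k e) = dot d p + k * dot d (unit_vec e).
Proof. unfold dot, translate; simpl; ring. Qed.

Lemma dot_unit_self (d : dir) : dot d (unit_vec d) = 1.
Proof. now destruct d. Qed.

Lemma dot_unit_bound (d e : dir) : -1 <= dot d (unit_vec e) <= 1.
Proof. destruct d, e; unfold dot; simpl; lia. Qed.

Lemma dot_unit_cases (d e : dir) :
  (dot (left_of d) (unit_vec e) = 1 \/ dot (left_of d) (unit_vec e) = -1)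
    /\ dot d (unit_vec e) = 0 \/
  dot (left_of d) (unit_vec e) = 0
    /\ (dot d (unit_vec e) = 1 /\ e = d \/ dot d (unit_vec e) = -1).
Proof. destruct d, e; cbn; intuition lia. Qed.

Lemma dot_inj (d : dir) (p q : Z * Z) :
  dot (left_of d) p = dot (left_of d) q -> dot d p = dot d q -> p = q.
Proof.
  destruct p as [a b], q as [a' b'].
  destruct d; unfold dot; cbn -[Z.mul Z.add]; intros; f_equal; lia.
Qed.

Lemma heading_S (sigma : list turn) (i : nat) (t : turn) :
  nth_error sigma i = Some t ->
  heading sigma (S i) = rotate (heading sigma i) t.
Proof.
  unfold heading. generalize East as d. revert i.
  induction sigma as [|s sigma IH]; intros [|i] d; simpl; try discriminate.
  - now intros [= ->].
  - apply IH.
Qed.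

Lemma heading_S_rotate (sigma : list turn) (i : nat) :
  (i < length sigma)%nat ->
  exists t, nth_error sigma i = Some t /\
            heading sigma (S i) = rotate (heading sigma i) t.
Proof.
  intros Hi. destruct (nth_error sigma i) as [t|] eqn:E.
  - exists t; split; [reflexivity | now apply heading_S].
  - apply nth_error_None in E; lia.
Qed.

Lemma heading_perp (sigma : list turn) (i : nat) :
  (i < length sigma)%nat -> perp (heading sigma i) (heading sigma (S i)).
Proof.
  intros Hi. destruct (heading_S_rotate sigma i Hi) as (t & _ & ->).
  now destruct (heading sigma i), t.
Qed.

(** * Walks with unit steps *)

(** Two successive opposite steps would return to the height held two steps earlier, against
    injectivity. *)
Lemma injective_column_monotone (X Y : nat -> Z) (a b : nat) :
  (a < b)%nat ->
  (forall u, (a <= u < b)%nat ->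
     X (S u) = X u /\ (Y (S u) = Y u + 1 \/ Y (S u) = Y u - 1)) ->
  (forall u u', (a <= u < u')%nat -> (u' <= b)%nat -> X u = X u' -> Y u <> Y u') ->
  (forall u, (a <= u < b)%nat -> Y (S u) = Y u + 1) \/
  (forall u, (a <= u < b)%nat -> Y (S u) = Y u - 1).
Proof.
  intros Hab. induction Hab as [|b Hab IH]; intros Hstep Hinj.
  - destruct (Hstep a) as [_ [H|H]]; [lia|left|right];
      intros u Hu; now replace u with a by lia.
  - assert (Hlast := Hstep b ltac:(lia)).
    assert (Hprev := Hstep (b - 1)%nat ltac:(lia)).
    assert (Hne := Hinj (b - 1)%nat (S b) ltac:(lia) ltac:(lia)).
    replace (S (b - 1)) with b in Hprev by lia.
    assert (Heq : Y b = Y (b - 1)%nat + 1 <-> Y (S b) = Y b + 1) by lia.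
    destruct IH as [IH|IH].
    + intros u Hu; apply Hstep; lia.
    + intros u u' H1 H2; apply Hinj; lia.
    + left; intros u Hu. specialize (IH (b - 1)%nat ltac:(lia)) as Hb.
      replace (S (b - 1)) with b in Hb by lia.
      destruct (Nat.eq_dec u b) as [->|]; [lia | apply IH; lia].
    + right; intros u Hu. specialize (IH (b - 1)%nat ltac:(lia)) as Hb.
      replace (S (b - 1)) with b in Hb by lia.
      destruct (Nat.eq_dec u b) as [->|]; [lia | apply IH; lia].
Qed.

(** Discrete intermediate value property: steps of size at most 1 cannot jump over [c]. *)
Lemma unit_steps_same_side (X : nat -> Z) (c : Z) (a b : nat) :
  (a <= b)%nat ->
  (forall u, (a <= u < b)%nat -> -1 <= X (S u) - X u <= 1) ->
  (forall u, (a <= u <= b)%nat -> X u <> c) ->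
  (X a < c <-> X b < c).
Proof.
  intros Hab. induction Hab as [|b Hab IH]; intros Hstep Hne; [tauto|].
  rewrite IH.
  - assert (H1 := Hstep b ltac:(lia)). assert (H2 := Hne b ltac:(lia)).
    assert (H3 := Hne (S b) ltac:(lia)). lia.
  - intros u Hu; apply Hstep; lia.
  - intros u Hu; apply Hne; lia.
Qed.

(* When the walk leaves column [X s] right after [s] and first returns at [t],
   the neighbours [s+1] and [t-1] lie in a common adjacent column, at the same
   heights as [s] and [t]; so the comparison is inherited from a shorter
   interval, or that interval is a single vertical run, hence not an up hook. *)
Lemma returns_lower (X Y : nat -> Z) (N : nat) :
  (forall u, (u < N)%nat ->
     ((X (S u) = X u + 1 \/ X (S u) = X u - 1) /\ Y (S u) = Y u) \/
     (X (S u) = X u /\ (Y (S u) = Y u + 1 \/ Y (S u) = Y u - 1))) ->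
  (forall u u', (u < u')%nat -> (u' <= N)%nat -> X u = X u' -> Y u <> Y u') ->
  (forall s t, (S s < t)%nat -> (S t <= N)%nat -> X s = X (S t) ->
     X (S s) <> X s ->
     (forall u, (S s <= u < t)%nat -> X (S u) = X u /\ Y (S u) = Y u + 1) ->
     False) ->
  forall s r t, (s < r < t)%nat -> (t <= N)%nat ->
    X s = X t -> X r <> X s -> Y t < Y s.
Proof.
  intros Hstep Hinj Hhook s r t.
  remember (t - s)%nat as m eqn:Em. revert s r t Em.
  induction m as [m IH] using lt_wf_ind.
  intros s r t Em Hr Ht Hst Hrs.
  assert (Hne := Hinj s t ltac:(lia) Ht Hst).
  assert (Hs := Hstep s ltac:(lia)).
  destruct t as [|t]; [lia|].
  assert (Hlast := Hstep t ltac:(lia)).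
  (* A vertical first step is dropped. Even if it goes up by 1, the shorter interval gives
     [Y (S t) <= Y s], and [Hne] makes this strict; a vertical last step is treated alike. *)
  destruct (Z.eq_dec (X (S s)) (X s)) as [Es|Es].
  { assert (r <> S s) by congruence.
    enough (Y (S t) < Y (S s)) by lia.
    apply (IH (S t - S s)%nat ltac:(lia) (S s) r); lia. }
  destruct (Z.eq_dec (X t) (X s)) as [Et|Et].
  { assert (r <> t) by congruence.
    enough (Y t < Y s) by lia.
    apply (IH (t - s)%nat ltac:(lia) s r); lia. }
  (* An intermediate return to the column splits the interval into two shorter ones. *)
  destruct (classic (exists q, (S s < q < t)%nat /\ X q = X s)) as [(q & Hq & Eq)|Hno].
  { apply Z.lt_trans with (Y q).
    - apply (IH (S t - q)%nat ltac:(lia) q t); lia.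
    - apply (IH (q - s)%nat ltac:(lia) s (S s)); lia. }
  assert (Hoff : forall u, (S s <= u <= t)%nat -> X u <> X s).
  { intros u Hu E. destruct (Nat.eq_dec u (S s)) as [->|]; [easy|].
    destruct (Nat.eq_dec u t) as [->|]; [easy|].
    apply Hno; exists u; split; [lia|easy]. }
  assert (Hside : X (S s) < X s <-> X t < X s).
  { apply unit_steps_same_side; [lia| |exact Hoff].
    intros u Hu. assert (H := Hstep u ltac:(lia)). lia. }
  assert (Hcol : X (S s) = X t) by lia.
  replace (Y (S t)) with (Y t) by lia. replace (Y s) with (Y (S s)) by lia.
  destruct (classic (exists q, (S s < q < t)%nat /\ X q <> X (S s))) as [(q & Hq & Eq)|Hrun].
  { apply (IH (t - S s)%nat ltac:(lia) (S s) q); lia. }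
  assert (Hlt : (S s < t)%nat).
  (* If [t = S s], two horizontal steps would bring the walk back to the very point it left. *)
  { assert (t <> S s) by (intros ->; lia). lia. }
  assert (Hconst : forall u, (S s <= u <= t)%nat -> X u = X (S s)).
  { intros u Hu. destruct (Nat.eq_dec u (S s)) as [->|]; [easy|].
    destruct (Nat.eq_dec u t) as [->|]; [easy|].
    destruct (Z.eq_dec (X u) (X (S s))); [easy|].
    exfalso; apply Hrun; exists u; split; [lia|easy]. }
  destruct (injective_column_monotone X Y (S s) t Hlt) as [Hup|Hdown].
  - intros u Hu. assert (H := Hstep u ltac:(lia)).
    assert (H1 := Hconst u ltac:(lia)). assert (H2 := Hconst (S u) ltac:(lia)). lia.
  - intros u u' H1 H2. apply Hinj; lia.
  - exfalso. apply (Hhook s t Hlt ltac:(lia) Hst Es). intros u Hu; split.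
    + rewrite (Hconst u), (Hconst (S u)); lia.
    + apply Hup; lia.
  - clear - Hdown Hlt. revert Hdown.
    induction Hlt as [|t Hlt IHt]; intros Hdown.
    + rewrite Hdown; lia.
    + rewrite Hdown by lia. enough (Y t < Y (S s)) by lia.
      apply IHt; intros u Hu; apply Hdown; lia.
Qed.

(** * Subdividing a chain into unit steps *)

(** A bend belongs to the segment that leaves it. Lengths being positive integers, the index grows
    by at most one per unit of time. *)
Fixpoint segment_at (l : nat -> Z) (u : nat) : nat :=
  match u with
  | O => O
  | S u' => let i := segment_at l u' in
            if travelled l (S i) <=? Z.of_nat u then S i else i
  end.

Definition walk (l : nat -> Z) (h : nat -> dir) (u : nat) : Z * Z :=
  let i := segment_at l u in
  translate (vertex l h i) (Z.of_nat u - travelled l i) (h i).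

Section PositiveLengths.

Variables (l : nat -> Z) (h : nat -> dir).
Hypothesis l_pos : forall i, 0 < l i.

Lemma travelled_lt (i j : nat) : (i < j)%nat -> travelled l i < travelled l j.
Proof.
  intros Hij. induction Hij; simpl; [specialize (l_pos i) | specialize (l_pos m)]; lia.
Qed.

Lemma travelled_nonneg (i : nat) : 0 <= travelled l i.
Proof. induction i; simpl; [lia|]. specialize (l_pos i). lia. Qed.

Lemma segment_at_spec (u : nat) :
  travelled l (segment_at l u) <= Z.of_nat u < travelled l (S (segment_at l u)).
Proof.
  induction u as [|u IH].
  - simpl. specialize (l_pos 0%nat). lia.
  - cbn [segment_at]. destruct (Z.leb_spec (travelled l (S (segment_at l u))) (Z.of_nat (S u))).
    + split; [assumption|]. simpl in IH |- *.
      specialize (l_pos (S (segment_at l u))). lia.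
    + split; [lia|assumption].
Qed.

Lemma segment_at_unique (u i : nat) :
  travelled l i <= Z.of_nat u < travelled l (S i) -> segment_at l u = i.
Proof.
  intros Hi. assert (Hs := segment_at_spec u).
  destruct (lt_eq_lt_dec (segment_at l u) i) as [[H|H]|H]; [|easy|].
  - assert (travelled l (S (segment_at l u)) <= travelled l i); [|lia].
    destruct (Nat.eq_dec (S (segment_at l u)) i) as [->|]; [lia|].
    apply Z.lt_le_incl, travelled_lt; lia.
  - assert (travelled l (S i) <= travelled l (segment_at l u)); [|lia].
    destruct (Nat.eq_dec (S i) (segment_at l u)) as [->|]; [lia|].
    apply Z.lt_le_incl, travelled_lt; lia.
Qed.

Lemma walk_travelled (i : nat) :
  walk l h (Z.to_nat (travelled l i)) = vertex l h i.
Proof.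
  assert (H0 := travelled_nonneg i). assert (Hl := l_pos i).
  unfold walk. rewrite (segment_at_unique _ i) by (simpl; lia).
  rewrite Z2Nat.id, Z.sub_diag by assumption. unfold translate.
  destruct (vertex l h i); simpl. f_equal; ring.
Qed.

Lemma segment_at_S (u : nat) :
  segment_at l (S u) = segment_at l u \/ segment_at l (S u) = S (segment_at l u).
Proof. cbn [segment_at]. destruct (_ <=? _); auto. Qed.

Lemma segment_at_le (u u' : nat) :
  (u <= u')%nat -> (segment_at l u <= segment_at l u')%nat.
Proof.
  induction 1 as [|u' _ IH]; [lia|]. destruct (segment_at_S u'); lia.
Qed.

Lemma walk_S (u : nat) : walk l h (S u) = translate (walk l h u) 1 (h (segment_at l u)).
Proof.
  assert (Hs := segment_at_spec u). unfold walk.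
  cbn [segment_at]. rewrite Nat2Z.inj_succ.
  set (i := segment_at l u) in *. cbn [travelled vertex] in *.
  (* In the first case time [S u] is exactly a bend: the new segment starts there with offset 0. *)
  destruct (Z.leb_spec (travelled l i + l i) (Z.succ (Z.of_nat u))).
  - cbn [travelled vertex]. replace (Z.of_nat u) with (travelled l i + l i - 1) by lia.
    unfold translate, Z.succ; cbn [fst snd]. f_equal; ring.
  - unfold translate, Z.succ; cbn [fst snd]. f_equal; ring.
Qed.

(** Segments are half-open in time. This excludes the common vertex, the one intersection that
    [simple_chain] tolerates. *)
Lemma walk_not_next_vertex (u : nat) :
  walk l h u <> vertex l h (S (segment_at l u)).
Proof.
  assert (Hs := segment_at_spec u). unfold walk. simpl in *.
  intros E. apply (f_equal (dot (h (segment_at l u)))) in E.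
  rewrite !dot_translate, dot_unit_self in E. lia.
Qed.

Lemma segment_at_lt (u m : nat) :
  Z.of_nat u < travelled l m -> (segment_at l u < m)%nat.
Proof.
  intros Hu. assert (Hs := segment_at_spec u).
  destruct (le_lt_dec m (segment_at l u)) as [Hle|]; [|assumption].
  assert (travelled l m <= travelled l (segment_at l u)); [|lia].
  destruct (Nat.eq_dec m (segment_at l u)) as [<-|]; [lia|].
  apply Z.lt_le_incl, travelled_lt; lia.
Qed.

End PositiveLengths.

(** * From simplicity in the real plane to injectivity of the lattice walk *)

Lemma translate_in_segment (p : Z * Z) (k m : Z) (d : dir) :
  0 < m -> 0 <= k <= m ->
  in_segment p (translate p m d) (to_plane (translate p k d)).
Proof.
  intros Hm Hk. exists (IZR k / IZR m)%R.
  assert (HmR : (0 < IZR m)%R) by now apply IZR_lt.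
  split; [split|].
  - apply Rmult_le_pos; [apply IZR_le; lia|].
    now apply Rlt_le, Rinv_0_lt_compat.
  - apply Rmult_le_reg_r with (IZR m); [easy|].
    unfold Rdiv. rewrite Rmult_assoc, Rinv_l, Rmult_1_l, Rmult_1_r by lra.
    apply IZR_le; lia.
  - unfold to_plane, translate; cbn [fst snd].
    rewrite !plus_IZR, !mult_IZR. f_equal; field; lra.
Qed.

Lemma to_plane_inj (a b : Z * Z) : to_plane a = to_plane b -> a = b.
Proof.
  destruct a, b; unfold to_plane; simpl. intros E. injection E as E1 E2.
  apply eq_IZR in E1, E2. congruence.
Qed.

Lemma realizes_lengths (sigma : list turn) (v : nat -> Z * Z) :
  realizes sigma v ->
  exists l, (forall i, 0 < l i) /\
    forall i, (i <= S (length sigma))%nat -> v i = vertex l (heading sigma) i.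
Proof.
  intros (H0 & Hv & _).
  (* The length of a segment is the gain of the coordinate along its own heading; the default 1 past
     the end keeps every length positive. *)
  exists (fun i => if le_lt_dec i (length sigma)
                   then dot (heading sigma i) (v (S i)) - dot (heading sigma i) (v i)
                   else 1).
  assert (Hd : forall i l, v (S i) = translate (v i) l (heading sigma i) ->
     dot (heading sigma i) (v (S i)) - dot (heading sigma i) (v i) = l).
  { intros i l ->. rewrite dot_translate, dot_unit_self. lia. }
  split.
  - intros i. destruct (le_lt_dec i (length sigma)) as [Hi|]; [|lia].
    destruct (Hv i Hi) as (l & Hl & E). now rewrite (Hd i l E).
  - induction i as [|i IH]; intros Hi; [exact H0|].
    simpl. rewrite <- IH by lia.
    destruct (le_lt_dec i (length sigma)) as [Hi'|]; [|lia].
    destruct (Hv i Hi') as (l & Hl & E). now rewrite (Hd i l E).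
Qed.

(** Within one segment the coordinate along the heading grows with time. Across segments, simplicity
    leaves only a common vertex, which the earlier time [u] has not yet reached. *)
Lemma walk_injective (l : nat -> Z) (h : nat -> dir) (n : nat) :
  (forall i, 0 < l i) ->
  simple_chain (S n) (vertex l h) ->
  forall u u', (u < u')%nat -> Z.of_nat u' <= travelled l (S n) ->
    walk l h u <> walk l h u'.
Proof.
  intros Hl Hsimple u u' Huu' Hu' E.
  assert (Hi : (segment_at l u < S n)%nat) by (apply segment_at_lt; [easy|lia]).
  assert (Hle := segment_at_le l u u' ltac:(lia)).
  assert (Hin : forall w, in_segment (vertex l h (segment_at l w))
             (vertex l h (S (segment_at l w))) (to_plane (walk l h w))).
  { intros w. assert (Hs := segment_at_spec l Hl w).
    unfold walk; simpl in *. apply translate_in_segment; [apply Hl|lia]. }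
  assert (Hnext := walk_not_next_vertex l h Hl u).
  destruct (Nat.eq_dec (segment_at l u) (segment_at l u')) as [Eseg|Hseg].
  - unfold walk in E. rewrite <- Eseg in E.
    apply (f_equal (dot (h (segment_at l u)))) in E.
    rewrite !dot_translate, dot_unit_self in E. lia.
  - destruct (le_lt_dec (S n) (segment_at l u')) as [Hend|Hj].
    (* The final time is assigned to segment [S n], outside the chain, so the endpoint is treated as
       the end of segment [n] instead. *)
    + assert (Eu' : Z.of_nat u' = travelled l (S n)).
      { assert (Hs := segment_at_spec l Hl u').
        destruct (Nat.eq_dec (S n) (segment_at l u')) as [En|]; [rewrite <- En in Hs; lia|].
        assert (Ht := travelled_lt l Hl (S n) (segment_at l u') ltac:(lia)). lia. }
      assert (Ew : walk l h u' = vertex l h (S n)).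
      { rewrite <- (walk_travelled l h Hl (S n)), <- Eu', Nat2Z.id. reflexivity. }
      destruct (Nat.eq_dec (segment_at l u) n) as [En|Hn].
      * rewrite En in Hnext. congruence.
      * destruct (Hsimple (segment_at l u) n (to_plane (walk l h u))) as [En Eq];
          [lia|lia|apply Hin| |].
        -- rewrite E, Ew. simpl. apply translate_in_segment; [apply Hl|].
           specialize (Hl n); lia.
        -- apply to_plane_inj in Eq. rewrite En in Eq. contradiction.
    + destruct (Hsimple (segment_at l u) (segment_at l u') (to_plane (walk l h u)))
        as [En Eq]; [lia|easy|apply Hin|rewrite E; apply Hin|].
      apply to_plane_inj in Eq. rewrite En in Eq. contradiction.
Qed.

(** * Chains without a hook in direction [d] *)

Lemma simple_chain_ext (m : nat) (v w : nat -> Z * Z) :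
  (forall i, (i <= m)%nat -> v i = w i) -> simple_chain m v -> simple_chain m w.
Proof.
  intros E H i j q Hij Hj. rewrite <- !E by lia. apply H; assumption.
Qed.

(** Every bend changes the heading to a perpendicular one, so a constant heading leaves no room for
    a bend. *)
Lemma constant_heading_segment (l : nat -> Z) (sigma : list turn) (d : dir) (a b : nat) :
  (a <= b)%nat -> (segment_at l b <= length sigma)%nat ->
  (forall u, (a <= u <= b)%nat -> heading sigma (segment_at l u) = d) ->
  segment_at l b = segment_at l a.
Proof.
  intros Hab. induction Hab as [|b Hab IH]; intros Hlen Hd; [easy|].
  destruct (segment_at_S l b) as [E|E].
  - rewrite E in *. apply IH; [easy|]. intros u Hu; apply Hd; lia.
  - assert (Hp := heading_perp sigma (segment_at l b) ltac:(lia)).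
    rewrite <- E in Hp. rewrite !Hd in Hp by lia.
    unfold perp in Hp. rewrite dot_unit_self in Hp. discriminate.
Qed.

(** Both neighbours of a segment along [d] are horizontal. Two different turns would give them the
    same direction and the sum 2 or -2, so the turns agree. *)
Lemma reversal_hook (sigma : list turn) (d : dir) (i : nat) :
  (S i < length sigma)%nat ->
  heading sigma (S i) = d ->
  dot (left_of d) (unit_vec (heading sigma i)) +
    dot (left_of d) (unit_vec (heading sigma (S (S i)))) = 0 ->
  has_hook d sigma.
Proof.
  intros Hi Hd Hrev.
  destruct (heading_S_rotate sigma i) as (t & Et & Ht); [lia|].
  destruct (heading_S_rotate sigma (S i)) as (t' & Et' & Ht'); [lia|].
  exists i, t. split; [easy|]. split; [|easy]. rewrite Et'.
  rewrite Ht' in Hrev. rewrite Hd in *. subst d. rewrite Ht in Hrev.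
  destruct (heading sigma i), t, t'; try reflexivity; discriminate.
Qed.

(** Without a hook, [returns_lower] applied between time 0 and the final time [N] puts the endpoint
    strictly below the origin. *)
Lemma reachable_hook (d : dir) (sigma : list turn) (p : Z * Z) :
  (0 < length sigma)%nat -> reachable sigma p ->
  dot (left_of d) p = 0 -> 0 < dot d p -> has_hook d sigma.
Proof.
  intros Hlen (v & Hreal & Hend) Hx Hy. apply NNPP; intros Hnohook.
  destruct (realizes_lengths sigma v Hreal) as (l & Hl & Hv).
  destruct Hreal as (_ & _ & Hsimple).
  apply (simple_chain_ext _ _ _ Hv) in Hsimple.
  rewrite Hv in Hend by lia. clear v Hv.
  set (h := heading sigma) in *. set (n := length sigma) in *.
  set (N := Z.to_nat (travelled l (S n))).
  assert (HN : Z.of_nat N = travelled l (S n)).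
  { apply Z2Nat.id, travelled_nonneg, Hl. }
  set (X := fun u => dot (left_of d) (walk l h u)).
  set (Y := fun u => dot d (walk l h u)).
  assert (HXS : forall u, X (S u) = X u + dot (left_of d) (unit_vec (h (segment_at l u)))).
  { intros u. unfold X. rewrite walk_S, dot_translate by assumption. ring. }
  assert (HYS : forall u, Y (S u) = Y u + dot d (unit_vec (h (segment_at l u)))).
  { intros u. unfold Y. rewrite walk_S, dot_translate by assumption. ring. }
  assert (Hseg : forall u, (u < N)%nat -> (segment_at l u <= n)%nat).
  { intros u Hu. assert (segment_at l u < S n)%nat; [|lia].
    apply segment_at_lt; [easy|lia]. }
  assert (HXv : forall k, X (Z.to_nat (travelled l k)) = dot (left_of d) (vertex l h k)).
  { intros k. unfold X. now rewrite walk_travelled. }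
  assert (HX0 : X 0%nat = 0) by (unfold X, dot; simpl; ring).
  assert (HXN : X N = 0) by (unfold N; now rewrite HXv, Hend).
  assert (HY0 : Y 0%nat = 0) by (unfold Y, dot; simpl; ring).
  assert (HYN : Y N = dot d p) by (unfold Y, N; now rewrite walk_travelled, Hend).
  (* The walk must leave the column of the origin before a return can be spoken of. As there is at
     least one turn, the first two segments are perpendicular, so one of them crosses columns. *)
  assert (Hleave : exists k, (k <= S n)%nat /\ dot (left_of d) (vertex l h k) <> 0).
  { assert (Hp := heading_perp sigma 0 Hlen). fold h in Hp.
    assert (Hl0 := Hl 0%nat). assert (Hl1 := Hl 1%nat).
    assert (H1 : dot (left_of d) (vertex l h 1%nat) = l 0%nat * dot (left_of d) (unit_vec (h 0%nat))).
    { simpl vertex. rewrite dot_translate. unfold dot; simpl; ring. }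
    assert (H2 : dot (left_of d) (vertex l h 2%nat) = dot (left_of d) (vertex l h 1%nat)
                 + l 1%nat * dot (left_of d) (unit_vec (h 1%nat))).
    { change (vertex l h 2%nat) with (translate (vertex l h 1%nat) (l 1%nat) (h 1%nat)).
      apply dot_translate. }
    destruct (Z.eq_dec (dot (left_of d) (vertex l h 1%nat)) 0) as [E|E];
      [|exists 1%nat; split; [lia|easy]].
    exists 2%nat. split; [lia|]. rewrite H2, E. rewrite E in H1.
    destruct d, (h 0%nat), (h 1%nat); unfold perp, dot in *; simpl in *; lia. }
  destruct Hleave as (k & Hk & Hkx).
  set (r := Z.to_nat (travelled l k)).
  assert (Hr : (0 < r < N)%nat).
  { assert (X r <> 0) by (unfold r; now rewrite HXv).
    assert (r <> 0%nat) by (intros E; rewrite E in *; congruence).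
    assert (r <> N) by (intros E; rewrite E in *; congruence).
    assert (r <= N)%nat; [|lia]. unfold r, N. apply Z2Nat.inj_le;
      [apply travelled_nonneg, Hl|apply travelled_nonneg, Hl|].
    destruct (Nat.eq_dec k (S n)) as [->|]; [lia|].
    apply Z.lt_le_incl, travelled_lt; [easy|lia]. }
  assert (Hbelow : Y N < Y 0%nat).
  { apply (returns_lower X Y N) with (r := r).
    - intros u Hu. rewrite HXS, HYS.
      assert (Haxis := dot_unit_cases d (h (segment_at l u))). lia.
    - intros u u' Huu' Hu' EX EY.
      apply (walk_injective l h n Hl Hsimple u u' Huu' ltac:(lia)).
      exact (dot_inj d _ _ EX EY).
    - intros s t Hst Ht EX Hs Hrun.
      assert (Hsegt := Hseg t ltac:(lia)).
      (* The step from [u] to [S u] follows [segment_at l u]; the last step of the run therefore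
         starts at [t - 1]. *)
      assert (Hmid : forall u, (S s <= u <= t - 1)%nat -> h (segment_at l u) = d).
      { intros u Hu. destruct (Hrun u ltac:(lia)) as [_ E]. rewrite HYS in E.
        destruct (dot_unit_cases d (h (segment_at l u))) as [[_ H]|[_ [[_ H]|H]]];
          [lia | exact H | lia]. }
      assert (Hcst : X t = X (S s)).
      { clear - Hst Hrun. induction Hst as [|t Hst IH].
        - apply Hrun; lia.
        - destruct (Hrun t) as [-> _]; [lia|]. apply IH; intros u Hu; apply Hrun; lia. }
      assert (HsX := HXS s). assert (HtX := HXS t).
      assert (Hd0 : dot (left_of d) (unit_vec d) = 0) by now destruct d.
      (* The steps before and after the run are horizontal, so they lie on other segments: the run
         is one whole segment between its two neighbours. *)
      assert (E1 : segment_at l (S s) = S (segment_at l s)).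
      { destruct (segment_at_S l s) as [E|E]; [|exact E].
        rewrite <- E, Hmid, Hd0 in HsX by lia. lia. }
      assert (E2 : segment_at l (t - 1) = segment_at l (S s)).
      { apply constant_heading_segment with sigma d; [lia| |exact Hmid].
        apply Hseg; lia. }
      assert (E3 : segment_at l t = S (segment_at l (t - 1))).
      { destruct (segment_at_S l (t - 1)) as [E|E];
          replace (S (t - 1)) with t in E by lia; [|exact E].
        rewrite E, Hmid, Hd0 in HtX by lia. lia. }
      assert (Et : segment_at l t = S (S (segment_at l s))) by congruence.
      apply Hnohook, (reversal_hook sigma d (segment_at l s)).
      + fold n. lia.
      + rewrite <- E1. apply Hmid; lia.
      (* [X s = X (S t)] and [X (S s) = X t], so the two horizontal steps cancel. *)
      + fold h. rewrite <- Et. lia.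
    - exact Hr.
    - lia.
    - now rewrite HX0, HXN.
    - rewrite HX0. unfold r. now rewrite HXv. }
  lia.
Qed.

(** * Chains with a prescribed hook *)

(** Coordinates are 1-Lipschitz in the travelled length; the estimates that keep distant segments
    apart rest on this. *)
Lemma dot_vertex_bound (l : nat -> Z) (h : nat -> dir) (e : dir) (i j : nat) :
  (forall k, 0 < l k) -> (i <= j)%nat ->
  - (travelled l j - travelled l i)
    <= dot e (vertex l h j) - dot e (vertex l h i)
    <= travelled l j - travelled l i.
Proof.
  intros Hl Hij. induction Hij as [|j _ IH]; [lia|].
  simpl. rewrite dot_translate. assert (Hb := dot_unit_bound e (h j)).
  specialize (Hl j). nia.
Qed.

Definition rdot (d : dir) (q : R * R) : R :=
  (IZR (fst (unit_vec d)) * fst q + IZR (snd (unit_vec d)) * snd q)%R.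

Lemma rdot_in_segment (d : dir) (a b : Z * Z) (q : R * R) :
  in_segment a b q ->
  exists t, (0 <= t <= 1)%R /\
    rdot d q = ((1 - t) * IZR (dot d a) + t * IZR (dot d b))%R.
Proof.
  intros (t & Ht & ->). exists t; split; [exact Ht|].
  unfold rdot, dot; cbn [fst snd]. rewrite !plus_IZR, !mult_IZR. ring.
Qed.

(** Half-planes are convex, and integrality turns [c <] into [c + 1 <=], a gap that also separates
    the real points of the segments. *)
Lemma separated_segments (d : dir) (c : Z) (a b a' b' : Z * Z) (q : R * R) :
  in_segment a b q -> in_segment a' b' q ->
  dot d a <= c -> dot d b <= c -> c < dot d a' -> c < dot d b' -> False.
Proof.
  intros H H' Ha Hb Ha' Hb'.
  destruct (rdot_in_segment d _ _ _ H) as (t & Ht & E).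
  destruct (rdot_in_segment d _ _ _ H') as (t' & Ht' & E').
  apply IZR_le in Ha, Hb. apply Z.le_succ_l, IZR_le in Ha', Hb'.
  rewrite succ_IZR in Ha', Hb'.
  assert (rdot d q <= IZR c)%R by (rewrite E; nra).
  assert (IZR c + 1 <= rdot d q)%R by (rewrite E'; nra).
  lra.
Qed.

(** The first segment fixes the coordinate across [d], the second the one along [d]; only the corner
    has both. *)
Lemma perp_segments_meet (p : Z * Z) (k m : Z) (d e : dir) (q : R * R) :
  perp d e ->
  in_segment p (translate p k d) q ->
  in_segment (translate p k d) (translate (translate p k d) m e) q ->
  q = to_plane (translate p k d).
Proof.
  intros Hp (t & _ & E) (s & _ & E'). rewrite E in E'. injection E' as E1 E2.
  rewrite E. unfold to_plane, translate in *; cbn [fst snd] in *.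
  rewrite !plus_IZR, !mult_IZR in *.
  destruct d, e; unfold perp, dot in Hp; simpl in *; try discriminate;
    f_equal; lra.
Qed.

(* Going away from the segment [S i] in either direction, each length exceeds
   the total of those beyond it, so the rest of the chain cannot get back to the
   line of an earlier segment; segment [S i] itself puts the two halves of the
   chain in disjoint half-planes. *)
Lemma dominant_lengths_simple (l : nat -> Z) (h : nat -> dir) (n i : nat) :
  (forall k, 0 < l k) ->
  (forall k, (k < n)%nat -> perp (h k) (h (S k))) ->
  (S i < n)%nat ->
  (forall k, (k <= i)%nat -> travelled l k < l k) ->
  (forall k, (S (S i) <= k <= n)%nat -> travelled l (S n) - travelled l (S k) < l k) ->
  travelled l i + (travelled l (S n) - travelled l (S (S (S i)))) < l (S i) ->
  simple_chain (S n) (vertex l h) /\ 0 < dot (h (S i)) (vertex l h (S n)).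
Proof.
  intros Hl Hperp Hi Hpre Hsuf Hmid.
  assert (HS : forall e k, dot e (vertex l h (S k))
             = dot e (vertex l h k) + l k * dot e (unit_vec (h k))).
  { intros e k. simpl. apply dot_translate. }
  assert (Hz : forall k, (k < n)%nat -> dot (h k) (unit_vec (h (S k))) = 0
                         /\ dot (h (S k)) (unit_vec (h k)) = 0).
  { intros k Hk. specialize (Hperp k Hk).
    destruct (h k), (h (S k)); unfold perp, dot in *; simpl in *; lia. }
  assert (Hmono : forall a b, (a <= b)%nat -> travelled l a <= travelled l b).
  { intros a b Hab. destruct (Nat.eq_dec a b) as [->|]; [lia|].
    apply Z.lt_le_incl, travelled_lt; [easy|lia]. }
  assert (Hbnd := fun e a b => dot_vertex_bound l h e a b Hl).
  set (f := h (S i)).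
  assert (Elow : dot f (vertex l h (S i)) = dot f (vertex l h i)).
  { rewrite HS. unfold f. destruct (Hz i ltac:(lia)) as [_ ->]. lia. }
  assert (Emid : dot f (vertex l h (S (S i))) = dot f (vertex l h (S i)) + l (S i)).
  { rewrite HS. unfold f. rewrite dot_unit_self. lia. }
  assert (Ehigh : dot f (vertex l h (S (S (S i)))) = dot f (vertex l h (S (S i)))).
  { rewrite HS. unfold f. destruct (Hz (S i) ltac:(lia)) as [-> _]. lia. }
  assert (Hlow : forall k, (k <= S i)%nat ->
     dot f (vertex l h k) <= dot f (vertex l h (S i)) + travelled l i).
  { intros k Hk. assert (H0 := travelled_nonneg l Hl i).
    destruct (Nat.eq_dec k (S i)) as [->|]; [lia|].
    assert (Hb := Hbnd f k i ltac:(lia)). assert (H0' := travelled_nonneg l Hl k). lia. }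
  assert (Hhigh : forall k, (S (S i) <= k <= S n)%nat ->
     dot f (vertex l h (S i)) + travelled l i < dot f (vertex l h k)).
  { intros k Hk. assert (H3 := Hmono (S (S (S i))) (S n) ltac:(lia)).
    destruct (Nat.eq_dec k (S (S i))) as [->|]; [lia|].
    assert (Hb := Hbnd f (S (S (S i))) k ltac:(lia)).
    assert (H4 := Hmono k (S n) ltac:(lia)). lia. }
  split.
  - intros a b q Hab Hb Ha Hq.
    destruct (Nat.eq_dec b (S a)) as [->|Hne].
    { split; [reflexivity|]. simpl in *.
      apply perp_segments_meet with (m := l (S a)) (e := h (S a)); try assumption.
      apply Hperp; lia. }
    exfalso. destruct (le_lt_dec (S i) a) as [Hsa|Hpa].
    (* Both segments lie at or after the hook: segment [S a] moves off the line of segment [a] by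
       more than all later segments can undo. *)
    + set (e := h (S a)).
      assert (Ea : dot e (vertex l h (S a)) = dot e (vertex l h a)).
      { rewrite HS. unfold e. destruct (Hz a ltac:(lia)) as [_ ->]. lia. }
      assert (Ea' : dot e (vertex l h (S (S a))) = dot e (vertex l h (S a)) + l (S a)).
      { rewrite HS. unfold e. rewrite dot_unit_self. lia. }
      assert (Hfar : forall k, (S (S a) <= k <= S n)%nat ->
         dot e (vertex l h a) < dot e (vertex l h k)).
      { intros k Hk. assert (Hbk := Hbnd e (S (S a)) k ltac:(lia)).
        assert (Hmk := Hmono k (S n) ltac:(lia)).
        assert (Hsk := Hsuf (S a) ltac:(lia)). lia. }
      apply (separated_segments e (dot e (vertex l h a)) _ _ _ _ q Ha Hq);
        [lia | lia | apply Hfar; lia | apply Hfar; lia].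
    + destruct (le_lt_dec b (S i)) as [Hpb|Hsb].
      * destruct b as [|b]; [lia|].
        (* Mirror case: segment [b] leads to the line of the later segment and outweighs everything
           before it. *)
        set (e := h b).
        assert (Eb : dot e (vertex l h (S (S b))) = dot e (vertex l h (S b))).
        { rewrite HS. unfold e. destruct (Hz b ltac:(lia)) as [-> _]. lia. }
        assert (Eb' : dot e (vertex l h (S b)) = dot e (vertex l h b) + l b).
        { rewrite HS. unfold e. rewrite dot_unit_self. lia. }
        assert (Hfar : forall k, (k <= b)%nat ->
           dot e (vertex l h k) <= dot e (vertex l h (S b)) - 1).
        { intros k Hk. assert (Hbk := Hbnd e k b ltac:(lia)).
          assert (H0 := travelled_nonneg l Hl k).
          assert (Hpk := Hpre b ltac:(lia)). lia. }
        apply (separated_segments e (dot e (vertex l h (S b)) - 1) _ _ _ _ q Ha Hq);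
          [apply Hfar; lia | apply Hfar; lia | lia | lia].
      * apply (separated_segments f (dot f (vertex l h (S i)) + travelled l i)
                 _ _ _ _ q Ha Hq);
          [apply Hlow; lia | apply Hlow; lia | apply Hhigh; lia | apply Hhigh; lia].
  (* The level that separates the two halves also separates the origin from the endpoint. *)
  - assert (H1 := Hlow 0%nat ltac:(lia)). assert (H2 := Hhigh (S n) ltac:(lia)).
    change (vertex l h 0%nat) with (0, 0) in H1.
    replace (dot f (0, 0)) with 0 in H1 by (unfold dot; simpl; ring). lia.
Qed.

(** * Lengths built from powers of 2 *)

(* [x] and [y] are the extra lengths of the two neighbours of the hook. *)
Definition hook_lengths (n i : nat) (x y : Z) (k : nat) : Z :=
  if (k <? i)%nat then 2 ^ Z.of_nat k
  else if (k =? i)%nat then 2 ^ Z.of_nat k + x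
  else if (k =? S i)%nat then 2 ^ Z.of_nat i + 2 ^ Z.of_nat n
  else if (k =? S (S i))%nat then 2 ^ Z.of_nat (n - k) + y
  else 2 ^ Z.of_nat (n - k).

Lemma pow2_pos (k : nat) : 0 < 2 ^ Z.of_nat k.
Proof. apply Z.pow_pos_nonneg; lia. Qed.

Lemma pow2_S (k : nat) : 2 ^ Z.of_nat (S k) = 2 * 2 ^ Z.of_nat k.
Proof. rewrite Nat2Z.inj_succ, Z.pow_succ_r; lia. Qed.

Ltac hook_cases :=
  unfold hook_lengths;
  repeat match goal with
  | |- context [(?a <? ?b)%nat] => destruct (Nat.ltb_spec a b)
  | |- context [(?a =? ?b)%nat] => destruct (Nat.eqb_spec a b)
  end; try lia.

Lemma hook_lengths_pos (n i : nat) (x y : Z) (k : nat) :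
  0 <= x -> 0 <= y -> 0 < hook_lengths n i x y k.
Proof.
  intros Hx Hy. assert (H1 := pow2_pos k). assert (H2 := pow2_pos i).
  assert (H3 := pow2_pos n). assert (H4 := pow2_pos (n - k)). hook_cases.
Qed.

(** The extra length [x] sits on segment [i], outside this range, so the geometric sum is exact for
    every [x]; [y] is likewise outside the suffix sums below. *)
Lemma travelled_hook_prefix (n i : nat) (x y : Z) (k : nat) :
  (k <= i)%nat -> travelled (hook_lengths n i x y) k = 2 ^ Z.of_nat k - 1.
Proof.
  induction k as [|k IH]; intros Hk; [reflexivity|].
  cbn [travelled]. rewrite IH, pow2_S by lia. hook_cases.
Qed.

Lemma travelled_hook_suffix (n i : nat) (x y : Z) (k : nat) :
  (S (S i) < k)%nat -> (k <= S n)%nat ->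
  travelled (hook_lengths n i x y) (S n) - travelled (hook_lengths n i x y) k
  = 2 ^ Z.of_nat (S n - k) - 1.
Proof.
  intros Hk Hn. remember (S n - k)%nat as m eqn:Em. revert k Hk Hn Em.
  induction m as [|m IH]; intros k Hk Hn Em.
  - replace k with (S n) by lia. simpl; lia.
  - specialize (IH (S k) ltac:(lia) ltac:(lia) ltac:(lia)).
    cbn [travelled] in IH |- *. rewrite pow2_S.
    assert (E : hook_lengths n i x y k = 2 ^ Z.of_nat m).
    { replace m with (n - k)%nat by lia. hook_cases. }
    lia.
Qed.

(** The extras [x] and [y] occur only on the larger side of the dominance inequalities, so they may
    be arbitrarily large. *)
Lemma hook_chain_simple (h : nat -> dir) (n i : nat) (x y : Z) :
  0 <= x -> 0 <= y ->
  (forall k, (k < n)%nat -> perp (h k) (h (S k))) ->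
  (S i < n)%nat ->
  simple_chain (S n) (vertex (hook_lengths n i x y) h) /\
  0 < dot (h (S i)) (vertex (hook_lengths n i x y) h (S n)).
Proof.
  intros Hx Hy Hperp Hi. apply dominant_lengths_simple; try assumption.
  - intros k. now apply hook_lengths_pos.
  - intros k Hk. rewrite travelled_hook_prefix by assumption. hook_cases.
  - intros k Hk. rewrite travelled_hook_suffix by lia.
    replace (S n - S k)%nat with (n - k)%nat by lia. hook_cases.
  (* The hook length [2 ^ i + 2 ^ n] is compared with [(2 ^ i - 1) + (2 ^ (n - i - 2) - 1)]. *)
  - rewrite travelled_hook_prefix, travelled_hook_suffix by lia.
    assert (2 ^ Z.of_nat (S n - S (S (S i))) <= 2 ^ Z.of_nat n)
      by (apply Z.pow_le_mono_r; lia).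
    hook_cases.
Qed.

(** Lengthening a segment translates everything after it. *)
Lemma hook_vertex_align (h : nat -> dir) (n i : nat) (e : dir) (x y : Z) (k : nat) :
  (S (S i) < k)%nat ->
  dot e (vertex (hook_lengths n i x y) h k)
  = dot e (vertex (hook_lengths n i 0 0) h k)
    + x * dot e (unit_vec (h i)) + y * dot e (unit_vec (h (S (S i)))).
Proof.
  assert (Hlow : forall m, (m <= i)%nat ->
    vertex (hook_lengths n i x y) h m = vertex (hook_lengths n i 0 0) h m).
  { induction m as [|m IH]; intros Hm; [reflexivity|].
    simpl. rewrite IH by lia. f_equal. hook_cases. }
  intros Hk. induction Hk as [|k Hk IH].
  - cbn [vertex]. rewrite Hlow, !dot_translate by lia.
    replace (hook_lengths n i x y (S i)) with (hook_lengths n i 0 0 (S i)) by hook_cases.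
    replace (hook_lengths n i x y i) with (hook_lengths n i 0 0 i + x) by hook_cases.
    replace (hook_lengths n i x y (S (S i)))
      with (hook_lengths n i 0 0 (S (S i)) + y) by hook_cases.
    ring.
  - cbn [vertex]. rewrite !dot_translate, IH.
    replace (hook_lengths n i x y k) with (hook_lengths n i 0 0 k) by hook_cases.
    ring.
Qed.

Lemma hook_reachable (d : dir) (sigma : list turn) :
  has_hook d sigma ->
  exists p, reachable sigma p /\ dot (left_of d) p = 0 /\ 0 < dot d p.
Proof.
  intros (i & t & Ei & Ei' & Hd).
  assert (Hi : (S i < length sigma)%nat) by (apply nth_error_Some; congruence).
  apply heading_S in Ei, Ei'.
  set (n := length sigma) in *. set (h := heading sigma) in *.
  (* Two equal turns reverse the heading. *)
  assert (Hx1 : dot (h i) (unit_vec (h (S (S i)))) = -1).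
  { rewrite Ei', Ei. now destruct (h i), t. }
  set (c := dot (h i) (vertex (hook_lengths n i 0 0) h (S n))).
  (* The extras move the endpoint by [x - y] along [h i]; this choice is nonnegative with
     [x - y = - c], cancelling the offset [c]. *)
  set (x := Z.max 0 (- c)). set (y := Z.max 0 c).
  exists (vertex (hook_lengths n i x y) h (S n)).
  destruct (hook_chain_simple h n i x y) as [Hsimple Hpos];
    [lia | lia | apply heading_perp | exact Hi |].
  split; [|split].
  - exists (vertex (hook_lengths n i x y) h). split; [|reflexivity].
    split; [reflexivity|]. split; [|exact Hsimple].
    intros k _. exists (hook_lengths n i x y k). split; [|reflexivity].
    apply hook_lengths_pos; lia.
  - assert (H0 : dot (h i) (vertex (hook_lengths n i x y) h (S n)) = 0).
    { rewrite hook_vertex_align, Hx1, dot_unit_self by lia. fold c. lia. }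
    (* [left_of d] is [h i] or its opposite, according to [t]. *)
    rewrite <- Hd, Ei. revert H0. generalize (vertex (hook_lengths n i x y) h (S n)).
    intros q H0. clear - H0.
    destruct (h i), t; unfold dot in *; cbn -[Z.mul Z.add] in *; lia.
  - rewrite <- Hd. exact Hpos.
Qed.

(** * The equivalence for one direction, and its four instances *)

Lemma hook_iff_reachable (d : dir) (sigma : list turn) (axis : Z * Z -> Prop) :
  (0 < length sigma)%nat ->
  (forall p, axis p <-> dot (left_of d) p = 0 /\ 0 < dot d p) ->
  has_hook d sigma <-> exists p, axis p /\ reachable sigma p.
Proof.
  intros Hlen Haxis; split.
  - intros H. destruct (hook_reachable d sigma H) as (p & Hp & Hdot).
    exists p; split; [now apply Haxis | exact Hp].
  - intros (p & Hp & Hreach). apply Haxis in Hp as [Hx Hy].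
    now apply reachable_hook with p.
Qed.

Theorem lemma4 : forall sigma : list turn,
  (0 < length sigma)%nat ->
  (has_hook North sigma <->
     exists p : Z * Z, on_pos_y_axis p /\ reachable sigma p) /\
  (has_hook South sigma <->
     exists p : Z * Z, on_neg_y_axis p /\ reachable sigma p) /\
  (has_hook East sigma <->
     exists p : Z * Z, on_pos_x_axis p /\ reachable sigma p) /\
  (has_hook West sigma <->
     exists p : Z * Z, on_neg_x_axis p /\ reachable sigma p).
Proof.
  intros sigma Hlen.
  split; [|split; [|split]]; apply hook_iff_reachable; try assumption;
    intros [a b];
    unfold on_pos_y_axis, on_neg_y_axis, on_pos_x_axis, on_neg_x_axis, dot;
    cbn -[Z.mul Z.add]; lia.
Qed.
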